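(* If $\alpha=0$, then for all $n\ge 1$ we have almost surely $\mathcal N(f_n,[0,2\pi])=2n$. If $\alpha\in\pi\mathbb Q$, then $$\lim_{n\to+\infty}\left|\frac{\mathbb E\left[\mathcal N(f_n,[0,2\pi])\right]}{n}-2\right|\mathbf 1_{n\alpha\in\pi\mathbb Z}=0.$$
   Context: Let $\alpha\ge 0$ be real. Let $(a_k)_{k\ge1}$ and $(b_k)_{k\ge1}$ be two independent (centered) stationary Gaussian processes with the same correlation function $\rho(k)=\cos(k\alpha)$, i.e. $\mathbb E[a_ka_l]=\mathbb E[b_kb_l]=\cos((k-l)\alpha)$ and $\mathbb E[a_kb_l]=0$ for all $k,l\ge1$. For $n\ge 1$ and $t\in\mathbb R$ set $f_n(t)=\frac{1}{\sqrt n}\sum_{k=1}^n\big(a_k\cos(kt)+b_k\sin(kt)\big)$. $\mathcal N(f_n,[0,2\pi])$ denotes the number of real zeros of $f_n$ in $[0,2\pi]$. $\mathbf 1_{n\alpha\in\pi\mathbb Z}$ equals $1$ if $n\alpha\in\pi\mathbb Z$ and $0$ otherwise. *)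

(* Defs.v *)
From HB Require Import structures.
From mathcomp Require Import all_boot all_order all_algebra.
From mathcomp Require Import all_classical all_reals all_analysis.
Set Implicit Arguments.
Unset Strict Implicit.
Unset Printing Implicit Defensive.
Import Order.TTheory GRing.Theory Num.Theory.
Import numFieldNormedType.Exports.
Local Open Scope classical_set_scope.
Local Open Scope ring_scope.

(** Processes are indexed by the integers [k >= 1]. They are represented by
    sequences on [nat] whose entry at [0] is never used. *)

(** A Gaussian variable may be degenerate, i.e. almost surely constant. The
    variance-zero case is a separate disjunct because [normal_prob m 0] is the
    uniform law on [[0, 1]] and not the Dirac mass at [m]. *)
Definition gaussian_variable (d : measure_display) (T : measurableType d)
    (R : realType) (P : probability T R) (X : T -> R) : Prop :=
  exists m : R,
    (exists2 s : R, 0 < s &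
      forall A, measurable A -> pushforward P X A = normal_prob m s A) \/
    (forall A, measurable A -> pushforward P X A = \d_m A).

Definition gaussian_process (d : measure_display) (T : measurableType d)
    (R : realType) (P : probability T R) (X : nat -> {RV P >-> R}) : Prop :=
  forall (n : nat) (c : nat -> R),
    gaussian_variable P (fun w => \sum_(1 <= k < n.+1) c k * X k w).

Definition stationary_gaussian_process (d : measure_display)
    (T : measurableType d) (R : realType) (P : probability T R)
    (rho : int -> R) (X : nat -> {RV P >-> R}) : Prop :=
  [/\ gaussian_process X,
      forall k, (1 <= k)%N -> ('E_P[X k] = 0)%E &
      forall k l, (1 <= k)%N -> (1 <= l)%N ->
        ('E_P[X k \* X l] = (rho (k%:Z - l%:Z))%:E)%E].

Definition process_sigma_algebra (d : measure_display) (T : measurableType d)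
    (R : realType) (P : probability T R) (X : nat -> {RV P >-> R}) :
    set (set T) :=
  <<s \bigcup_(k in [set k | (1 <= k)%N])
        preimage_set_system setT (X k) measurable >>.

Definition independent_processes (d : measure_display) (T : measurableType d)
    (R : realType) (P : probability T R) (X Y : nat -> {RV P >-> R}) : Prop :=
  forall A B, process_sigma_algebra X A -> process_sigma_algebra Y B ->
    P (A `&` B) = (P A * P B)%E.

Definition random_trig_poly (d : measure_display) (T : measurableType d)
    (R : realType) (P : probability T R) (a b : nat -> {RV P >-> R})
    (n : nat) (w : T) (t : R) : R :=
  (Num.sqrt n%:R)^-1 *
  \sum_(1 <= k < n.+1) (a k w * cos (k%:R * t) + b k w * sin (k%:R * t)).

(** Number of distinct zeros, without multiplicity; [+oo] if infinitely many. *)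
Definition num_zeros (R : realType) (f : R -> R) (D : set R) : \bar R :=
  counting [set t | D t /\ f t = 0].

Definition pi_int (R : realType) : set R := range (fun m : int => pi * m%:~R).

Definition pi_rat (R : realType) : set R := range (fun q : rat => pi * ratr q).
Arguments pi_int {R}.
Arguments pi_rat {R}.

(* Main.v *)
Require Import Defs.
From HB Require Import structures.
From mathcomp Require Import all_boot all_order all_algebra.
From mathcomp Require Import all_classical all_reals all_analysis.
From mathcomp Require Import measurable_realfun complex ring lra zify.
Import Order.TTheory GRing.Theory Num.Theory.
Import numFieldNormedType.Exports.
Local Open Scope classical_set_scope.
Local Open Scope ring_scope.

(** The covariance [cos ((k - l) alpha)] has rank two: almost surely
    [a k.+2 + a k = 2 cos alpha * a k.+1] for all [k], and similarly for [b].
    Multiplying [f_n t] by [2 (cos t - cos alpha)] therefore telescopes the sum.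
    If [n alpha = m pi], then [a (n + k) = (-1)^m a k], and the result factors as
    [2 sin theta * h] with [theta = (n t + m pi) / 2] and
    [h = a_1 sin theta - a_0 sin (t + theta) + b_0 cos (t + theta) - b_1 cos theta].
    The first factor has [n] zeros in a period. At these zeros
    [h = +- (b_0 cos t - a_0 sin t - b_1)] with alternating signs; the function in
    brackets does not depend on [n] and has at most two zeros in a period, so [h]
    changes sign between all but boundedly many consecutive zeros of [sin theta].
    Hence [f_n] has at least [2 n - 7] zeros, and at most [2 n + 1] because it is
    a nonzero trigonometric polynomial of degree [n]. Both bounds are
    deterministic, so neither measurability of the number of zeros nor a limit
    theorem is needed for the expectation.

    If [alpha = 0], then [sin (t / 2) * f_n t] is, up to a constant,
    [sin (n t / 2) * (a_1 cos ((n + 1) t / 2) + b_1 sin ((n + 1) t / 2))], whose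
    factors have [n - 1] and [n + 1] zeros in the open interval, almost surely
    without coincidence by independence of [a_1] and [b_1]. *)

(** * Elementary facts on sine and cosine *)

Lemma sin_neq0 (R : realType) (x : R) : - pi < x < pi -> x != 0 -> sin x != 0.
Proof.
move=> /andP[x1 x2]; rewrite neq_lt => /orP[x0|x0].
  by rewrite -oppr_eq0 -sinN gt_eqF// sin_gt0_pi// oppr_gt0 x0 ltrNl.
by rewrite gt_eqF// sin_gt0_pi// x0.
Qed.

Lemma cos_sin_inj (R : realType) (s t : R) : 0 <= s < 2 * pi ->
  0 <= t < 2 * pi -> cos s = cos t -> sin s = sin t -> s = t.
Proof.
move=> /andP[s0 s2] /andP[t0 t2] cst sst; apply/eqP; rewrite -subr_eq0.
apply/negPn/negP => st0.
have : sin ((s - t) / 2) != 0.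
  apply: sin_neq0; first by apply/andP; split; lra.
  by rewrite mulf_neq0// invr_neq0// pnatr_eq0.
have : cos (s - t) = 1 by rewrite cosB cst sst -!expr2 cos2Dsin2.
rewrite [in cos _](_ : s - t = (s - t) / 2 + (s - t) / 2); last by field.
rewrite cosD -!expr2 cos2sin2 => h; apply/negP/negPn; rewrite -sqrf_eq0.
by apply/eqP; lra.
Qed.

(** * Number of zeros of a trigonometric polynomial *)

Section trigonometric_polynomials.
Context {R : realType}.
Implicit Types (s : seq R) (u v : nat -> R) (t : R).

Let expi t : R[i] := (cos t +i* sin t)%C.

Let expiX t n : expi t ^+ n = expi (n%:R * t).
Proof.
elim: n => [|n IH]; first by rewrite expr0 mul0r /expi cos0 sin0.
rewrite exprS IH /expi -natr1 mulrDl mul1r [_ + t]addrC cosD sinD.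
by apply/eqP; rewrite eq_complex /= !(mulrC (sin t)) addrC eqxx/= [X in _ == X]addrC.
Qed.

Definition trig_poly u v N t : R :=
  \sum_(0 <= k < N.+1) (u k * cos (k%:R * t) + v k * sin (k%:R * t)).

(** With [z = e^(i t)], twice the [k]-th term of [trig_poly] is
    [(u k - i v k) z^k + (u k + i v k) z^(-k)]; the factor [z^N] clears the negative powers. *)
Let laurent u v N : {poly R[i]} :=
  \sum_(0 <= k < N.+1) ((u k -i* v k)%C *: 'X^(N + k) +
                        (u k +i* v k)%C *: 'X^(N - k)).

Let horner_laurent u v N t :
  (laurent u v N).[expi t] = 2 * expi t ^+ N * (trig_poly u v N t)%:C%C.
Proof.
rewrite /trig_poly rmorph_sum /= mulr_sumr horner_sum.
apply: eq_big_nat => k /andP[_]; rewrite ltnS => kN.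
rewrite !hornerE.
have -> : expi t ^+ (N - k) = expi t ^+ N * (cos (k%:R * t) -i* sin (k%:R * t))%C.
  rewrite -[in RHS](subnK kN) exprD -mulrA [X in _ * X](_ : _ = 1) ?mulr1//.
  rewrite expiX; apply/eqP; rewrite eq_complex /=.
  apply/andP; split; apply/eqP; last by ring.
  by rewrite mulrN opprK -!expr2 cos2Dsin2.
rewrite exprD [expi t ^+ k]expiX.
rewrite [(u k -i* v k)%C * _]mulrCA [(u k +i* v k)%C * _]mulrCA -mulrDr.
rewrite [2 * _]mulrC -mulrA; congr (_ * _).
by apply/eqP; rewrite eq_complex /=; apply/andP; split; apply/eqP; ring.
Qed.

Let size_laurent u v N : (size (laurent u v N) <= (N + N).+1)%N.
Proof.
rewrite /laurent big_mkord; apply: (leq_trans (size_sum _ _ _)); apply/bigmax_leqP => k _.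
have kN : (k <= N)%N by rewrite -ltnS.
apply: (leq_trans (size_polyD _ _)); rewrite geq_max.
apply/andP; split; apply: (leq_trans (size_scale_leq _ _)).
  by rewrite size_polyXn ltnS leq_add2l.
by rewrite size_polyXn ltnS leq_subLR addnA leq_addl.
Qed.

(** The coefficient of degree [N + k] has real part [u k], or [2 * u k] when [k = 0], where the two
    monomials coincide. No other index contributes to it. *)
Let laurent_neq0 u v N k : (k <= N)%N -> u k != 0 -> laurent u v N != 0.
Proof.
move=> kN uk0; apply/negP => /eqP /(congr1 (fun p : {poly R[i]} => complex.Re p`_(N + k))).
rewrite coef0 /= => /eqP; apply/negP.
rewrite coef_sum raddf_sum /= big_mkord (bigD1 (Ordinal (kN : (k < N.+1)%N)))//=.
rewrite big1 => [|j jk].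
  rewrite addr0 coefD !coefZ !coefXn /= eqxx.
  have [_|_] := eqVneq (N + k)%N (N - k)%N.
    rewrite (_ : complex.Re _ = 2 * u k); last by rewrite /=; ring.
    by rewrite mulf_neq0// pnatr_eq0.
  by rewrite /= !(mulr0, mulr1, oppr0, addr0, subr0).
rewrite coefD !coefZ !coefXn eqn_add2l.
have -> : (k == j :> nat) = false by apply/negP => /eqP kj; move/eqP: jk; apply; exact/val_inj.
have -> : (N + k == N - j)%N = false.
  by apply/negP => /eqP E; move/eqP: jk; apply; apply/val_inj => /=; have := ltn_ord j; lia.
by rewrite /=; ring.
Qed.

(** Distinct points of [[0, 2 pi[] give distinct roots on the unit circle of a nonzero polynomial of
    degree at most [2 N]. *)
Lemma trig_poly_zeros u v N k s : (k <= N)%N -> u k != 0 -> uniq s ->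
  (forall t, t \in s -> 0 <= t < 2 * pi) ->
  (forall t, t \in s -> trig_poly u v N t = 0) -> (size s <= N + N)%N.
Proof.
move=> kN uk0 us s2 s0; rewrite -ltnS.
apply: leq_trans (size_laurent u v N).
rewrite -(size_map expi); apply: max_poly_roots.
- exact: laurent_neq0 uk0.
- apply/allP => _ /mapP[t ts ->].
  by rewrite /root horner_laurent s0// mulr0.
- rewrite map_inj_in_uniq// => x y xs ys [cxy sxy].
  by apply: cos_sin_inj => //; exact: s2.
Qed.

End trigonometric_polynomials.

(** * Counting measure compared with lists of distinct points *)

Lemma counting_ge_size (R : realType) (T : choiceType) (A : set T) (s : seq T) :
  uniq s -> (forall x, x \in s -> A x) ->
  ((size s)%:R%:E <= counting A :> \bar R)%E.
Proof.
move=> us sA; rewrite /counting; case: asboolP => [fA|_]; last exact: leey.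
rewrite lee_fin ler_nat; apply: uniq_leq_size => // x xs.
by rewrite in_fset_set// inE; exact: sA.
Qed.

Lemma counting_le_size (R : realType) (T : choiceType) (A : set T) (n : nat) :
  (forall s : seq T, uniq s -> (forall x, x \in s -> A x) -> (size s <= n)%N) ->
  (counting A <= n%:R%:E :> \bar R)%E.
Proof.
move=> An; rewrite /counting; case: asboolP => [fA|/(infinite_set_fset n.+1)].
  rewrite lee_fin ler_nat; apply: An; first exact: finmap.fset_uniq.
  by move=> x; rewrite in_fset_set// inE.
move=> [B BA]; rewrite leqNgt ltnS An//; exact: finmap.fset_uniq.
Qed.

(** * Zeros produced by sign changes *)

Section sign_changes.
Context {R : realType} {p : nat -> R}.
Context {f : R -> R}.
Hypothesis (incp : forall j, p j < p j.+1).

Lemma increasing_points i j : (i <= j)%N -> p i <= p j.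
Proof.
elim: j => [|j IH]; first by rewrite leqn0 => /eqP->.
rewrite leq_eqVlt => /orP[/eqP->//|]; rewrite ltnS => /IH /le_trans; apply.
exact/ltW.
Qed.

Lemma sign_change_zeros (cf : continuous f) : exists z : nat -> R, forall j,
  f (p j) * f (p j.+1) < 0 -> p j < z j < p j.+1 /\ f (z j) = 0.
Proof.
suff H j : exists z, f (p j) * f (p j.+1) < 0 ->
    p j < z < p j.+1 /\ f z = 0.
  by have [z zP] := choice H; exists z.
(* Where there is no sign change, [0] is a mere placeholder. *)
have [fj|_] := ltP (f (p j) * f (p j.+1)) 0; last by exists 0.
have [z zj fz] : exists2 z, z \in `[p j, p j.+1] & f z = 0.
  apply: IVT; first exact/ltW.
    exact: continuous_subspaceT.
  rewrite ge_min le_max.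
  apply/andP; split; apply/negPn/negP; rewrite negb_or -!ltNge => /andP[a0 b0].
    by move: fj; rewrite ltNge mulr_ge0// ltW.
  by move: fj; rewrite ltNge mulr_le0// ltW.
exists z => _; split=> //; move: zj; rewrite in_itv /= !lt_neqAle => /andP[-> ->].
(* A zero at an end point would make the product vanish. *)
rewrite !andbT; apply/andP; split; apply/eqP => E; move: fj.
  by rewrite E fz mul0r ltxx.
by rewrite -E fz mulr0 ltxx.
Qed.

Lemma between_inj (z : nat -> R) (i j : nat) :
  p i < z i < p i.+1 -> p j < z j < p j.+1 -> z i = z j -> i = j.
Proof.
move=> /andP[i1 i2] /andP[j1 j2] zij; apply/eqP; rewrite eqn_leq.
by apply/andP; split; rewrite leqNgt; apply/negP => /increasing_points; lra.
Qed.

Lemma between_neq (x : R) (i j : nat) : p i < x < p i.+1 -> x <> p j.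
Proof.
move=> /andP[i1 i2] xj; case: (leqP j i) => /increasing_points; lra.
Qed.

End sign_changes.

(** * Trigonometric sums and the case of constant coefficients *)

Lemma cos_natpi (R : realType) (n : nat) : cos (n%:R * pi : R) = (-1) ^+ n.
Proof.
rewrite mulrC mulr_natr -[X in cos X]add0r (alternatingn (@cosDpi R)) cos0.
exact: mulr1.
Qed.

Lemma sin_natpi (R : realType) (n : nat) : sin (n%:R * pi : R) = 0.
Proof.
rewrite mulrC mulr_natr -[X in sin X]add0r (alternatingn (@sinDpi R)) sin0.
exact: mulr0.
Qed.

Section trigonometric_sums.
Context {R : realType}.
Implicit Types (x y : nat -> R) (t : R).

Definition trig_sum x y n t : R :=
  \sum_(1 <= k < n.+1) (x k * cos (k%:R * t) + y k * sin (k%:R * t)).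

Lemma trig_sum_zeros x y n s : (1 <= n)%N -> x 1%N != 0 -> uniq s ->
  (forall t, t \in s -> 0 <= t < 2 * pi) ->
  (forall t, t \in s -> trig_sum x y n t = 0) -> (size s <= 2 * n)%N.
Proof.
move=> n1 x1 us s2 s0; rewrite mul2n -addnn.
pose u k := if k == 0%N then 0 else x k.
apply: (@trig_poly_zeros _ u y n 1%N) => // t /s0 <-.
rewrite /trig_poly big_ltn// !(mul0r, sin0, mulr0, add0r).
by apply: eq_big_nat => -[].
Qed.

Lemma num_zeros_le x y n : (1 <= n)%N -> x 1%N != 0 ->
  (num_zeros (trig_sum x y n) `[0%R, (2 * pi)%R] <= ((2 * n).+1)%:R%:E)%E.
Proof.
move=> n1 x1; apply: counting_le_size => s us sz.
have le1 : (count_mem (2 * pi)%R s <= 1)%N by rewrite count_uniq_mem// leq_b1.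
rewrite -(count_predC (pred1 (2 * pi : R)) s) addnC -[(2 * n).+1]addn1 leq_add//.
rewrite -size_filter; apply: (@trig_sum_zeros x y n) => //.
- exact: filter_uniq.
- move=> t; rewrite mem_filter /= => /andP[t2 /sz[]].
  by rewrite /= in_itv /= => /andP[-> +] _; rewrite le_eqVlt (negbTE t2).
- by move=> t; rewrite mem_filter => /andP[_ /sz[]].
Qed.

Lemma trig_sum_2pi x y n : trig_sum x y n (2 * pi) = \sum_(1 <= k < n.+1) x k.
Proof.
apply: eq_bigr => k _; rewrite mulrA -natrM cos_natpi sin_natpi mulr0 addr0.
by rewrite mulnC exprM sqrrN expr1n expr1n mulr1.
Qed.

(** A closed form of Dirichlet kernel type: it splits the sum into two factors whose zeros are
    located separately. *)
Lemma trig_sum_const (a b : R) n t :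
  sin (t / 2) * trig_sum (fun=> a) (fun=> b) n t =
  sin (n%:R * (t / 2)) *
    (a * cos (n.+1%:R * (t / 2)) + b * sin (n.+1%:R * (t / 2))).
Proof.
elim: n => [|n IH].
  by rewrite /trig_sum big_nil mul0r sin0 mulr0 mul0r.
rewrite /trig_sum big_nat_recr//= mulrDr [sin _ * bigop _ _ _]IH.
set h := t / 2.
have -> : n.+1%:R * t = n.+1%:R * h + n.+1%:R * h by rewrite /h; field.
have -> : n.+2%:R * h = n.+1%:R * h + h by rewrite -[n.+2%:R]natr1; ring.
have -> : n%:R * h = n.+1%:R * h - h by rewrite -natr1; ring.
set w := n.+1%:R * h; rewrite sinB !cosD !sinD.
ring.
Qed.

(** The two factors have [n - 1] and [n + 1] zeros inside the period, and the hypothesis on [i]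
    keeps them apart. At [2 pi] the sum is [n a], which is nonzero, so the bound [2 n] extends to
    the closed interval. *)
Lemma num_zeros_const (a b : R) n : (1 <= n)%N -> a != 0 ->
  (forall i, (0 < i < n)%N ->
     a * cos (n.+1%:R * (i%:R * pi / n%:R)) +
     b * sin (n.+1%:R * (i%:R * pi / n%:R)) != 0) ->
  num_zeros (trig_sum (fun=> a) (fun=> b) n) `[0, (2 * pi)] = (2 * n)%:R%:E.
Proof.
move=> n1 a0 ab0.
have pi0 := pi_gt0 R; have n0 : 0 < n%:R :> R by rewrite ltr0n.
apply/eqP; rewrite eq_le; apply/andP; split.
  apply: counting_le_size => s us sz.
  apply: (@trig_sum_zeros (fun=> a) (fun=> b) n) => // t /sz[] //.
  rewrite /= in_itv /= => /andP[-> +] ft0; rewrite le_eqVlt => /orP[/eqP E|//].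
  move/eqP: ft0; rewrite E trig_sum_2pi sumr_const_nat subSS subn0.
  by rewrite mulrn_eq0 (negbTE a0) orbF eqn0Ngt n1.
pose g t := a * cos (n.+1%:R * (t / 2)) + b * sin (n.+1%:R * (t / 2)).
have ch : continuous (fun t : R => n.+1%:R * (t / 2)).
  by move=> t; apply: cvgMr; apply: cvgMl.
have cg : continuous g.
  move=> t; apply: cvgD; apply: cvgMr.
    exact: (continuous_comp (ch t) (@continuous_cos R _)).
  exact: (continuous_comp (ch t) (@continuous_sin R _)).
(* At these points the sine term of [g] vanishes and [g] is alternately [a] and [- a]. *)
pose p j : R := 2 * pi * j%:R / n.+1%:R.
have incp j : p j < p j.+1.
  by rewrite /p ltr_pM2r ?invr_gt0 ?ltr0n// ltr_pM2l ?mulr_gt0// ltr_nat.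
have gp j : g (p j) = a * (-1) ^+ j.
  rewrite /g (_ : n.+1%:R * _ = j%:R * pi); last first.
    by rewrite /p; field; rewrite addrC natr1 pnatr_eq0.
  by rewrite cos_natpi sin_natpi mulr0 addr0.
have [z zP] := sign_change_zeros incp cg.
have {zP} zP j : p j < z j < p j.+1 /\ g (z j) = 0.
  apply: zP; rewrite !gp exprS mulN1r mulrN mulrN oppr_lt0.
  by rewrite mulrACA -exprMn mulrNN mulr1 expr1n mulr1 -expr2 exprn_even_gt0.
(* Zeros of [sin (n t / 2)], inside the period for [0 < i < n]. *)
pose q i : R := 2 * (i%:R * pi / n%:R).
have zero t : 0 < t < 2 * pi -> sin (n%:R * (t / 2)) * g t = 0 ->
    [set t | `[0, (2 * pi)]%classic t /\ trig_sum (fun=> a) (fun=> b) n t = 0] t.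
  move=> /andP[t0 t2] tg; split; first by rewrite /= in_itv /= !ltW.
  have /mulfI : sin (t / 2) != 0.
    apply: sin_neq0; first by apply/andP; split; lra.
    by rewrite mulf_neq0 ?invr_neq0 ?pnatr_eq0// gt_eqF.
  by apply; rewrite trig_sum_const mulr0.
have uz : uniq ([seq q i | i <- iota 1 n.-1] ++ [seq z j | j <- iota 0 n.+1]).
  rewrite cat_uniq; apply/and3P; split.
  - rewrite map_inj_uniq ?iota_uniq// => i j.
    have two0 : 2 != 0 :> R by rewrite pnatr_eq0.
    move=> /(mulfI two0) /(mulIf (invr_neq0 (lt0r_neq0 n0))).
    by move=> /(mulIf (lt0r_neq0 pi0)) /eqP; rewrite eqr_nat => /eqP.
  - apply/hasPn => _ /mapP[j _ ->]; apply/mapP => -[k]; rewrite mem_iota => kP E.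
    have /ab0 : (0 < k < n)%N by lia.
    have [_] := zP j; rewrite E /g /q.
    rewrite [_ / 2](_ : _ = k%:R * pi / n%:R); last by field; rewrite gt_eqF.
    by move=> ->; rewrite eqxx.
  - rewrite map_inj_in_uniq ?iota_uniq// => i j _ _.
    exact: (between_inj incp _ _ _ (proj1 (zP i)) (proj1 (zP j))).
rewrite (_ : (2 * n)%N = size ([seq q i | i <- iota 1 n.-1] ++
   [seq z j | j <- iota 0 n.+1])); last first.
  by rewrite size_cat !size_map !size_iota; lia.
apply: counting_ge_size => // t; rewrite mem_cat => /orP[|] /mapP[k].
  rewrite mem_iota => kP ->; apply: zero; last first.
    rewrite (_ : n%:R * _ = k%:R * pi) ?sin_natpi ?mul0r//.
    by rewrite /q; field; rewrite gt_eqF.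
  have k0 : 0 < k%:R :> R by rewrite ltr0n; lia.
  have km : k%:R < n%:R :> R by rewrite ltr_nat; lia.
  rewrite /q mulr_gt0 ?divr_gt0 ?mulr_gt0//=.
  by rewrite ltr_pM2l// ltr_pdivrMr// mulrC ltr_pM2l.
rewrite mem_iota => kP ->; have [/andP[z1 z2] gz] := zP k.
apply: zero; last by rewrite gz mulr0.
have pa : 0 <= p k by rewrite /p divr_ge0// !mulr_ge0// ltW.
have pb : p k.+1 <= 2 * pi.
  by rewrite /p ler_pdivrMr ?ltr0n// ler_pM2l ?mulr_gt0// ler_nat; lia.
by apply/andP; split; lra.
Qed.

End trigonometric_sums.

(** * Lower bound on the zeros when [n alpha = m pi] *)

Section commensurable_angle.
Context {R : realType}.
Implicit Types (x y C : nat -> R) (t c d : R).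

(* Both sequences solve a three-term recurrence of the same kind, so the sum
   telescopes to a difference of Casoratians. *)
Lemma casoratian_sum x C n c d : (forall k, C k.+2 + C k = 2 * c * C k.+1) ->
  (forall k, (k < n)%N -> x k.+2 + x k = 2 * d * x k.+1) ->
  2 * (c - d) * (\sum_(1 <= k < n.+1) x k * C k) =
  x 1%N * C 0%N - x 0%N * C 1%N + x n * C n.+1 - x n.+1 * C n.
Proof.
move=> recC; elim: n => [|n IH] recx; first by rewrite big_nil; ring.
rewrite big_nat_recr//= mulrDr IH => [|k kn]; last exact/recx/ltnW.
have -> : C n.+2 = 2 * c * C n.+1 - C n by rewrite -recC addrK.
have -> : x n.+2 = 2 * d * x n.+1 - x n by rewrite -recx ?addrK.
ring.
Qed.

Lemma cos_recurrence t k :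
  cos (k.+2%:R * t) + cos (k%:R * t) = 2 * cos t * cos (k.+1%:R * t).
Proof.
have -> : k.+2%:R * t = k.+1%:R * t + t by rewrite -[k.+2%:R]natr1; ring.
have -> : k%:R * t = k.+1%:R * t - t by rewrite -natr1; ring.
by rewrite cosB cosD; ring.
Qed.

Lemma sin_recurrence t k :
  sin (k.+2%:R * t) + sin (k%:R * t) = 2 * cos t * sin (k.+1%:R * t).
Proof.
have -> : k.+2%:R * t = k.+1%:R * t + t by rewrite -[k.+2%:R]natr1; ring.
have -> : k%:R * t = k.+1%:R * t - t by rewrite -natr1; ring.
by rewrite sinB sinD; ring.
Qed.

(** Here [x] and [y] stand for sample paths extended to index [0], [d] for [cos alpha] and [b] for
    the parity of [m]. *)
Context {x y : nat -> R} {n : nat} {b : bool} {d : R}.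
Hypotheses (n_gt0 : (0 < n)%N)
  (recx : forall k, (k < n)%N -> x k.+2 + x k = 2 * d * x k.+1)
  (recy : forall k, (k < n)%N -> y k.+2 + y k = 2 * d * y k.+1)
  (xn : x n = (-1) ^+ b * x 0%N) (xn1 : x n.+1 = (-1) ^+ b * x 1%N)
  (yn : y n = (-1) ^+ b * y 0%N) (yn1 : y n.+1 = (-1) ^+ b * y 1%N)
  (y1 : y 1%N != 0).

(* [(-1) ^+ b * e^(i n t) = e^(2 i theta t)]: this halving of the angle makes
   [sin (theta t)] a factor of the telescoped sum. *)
Let theta t := n%:R / 2 * t + b%:R * pi / 2.

Let h t := x 1%N * sin (theta t) - x 0%N * sin (t + theta t) +
           y 0%N * cos (t + theta t) - y 1%N * cos (theta t).

Let factorization t :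
  2 * (cos t - d) * trig_sum x y n t = 2 * sin (theta t) * h t.
Proof.
rewrite /trig_sum big_split /= mulrDr.
rewrite (casoratian_sum _ (fun k => cos (k%:R * t)) _ _ _ (cos_recurrence t) recx).
rewrite (casoratian_sum _ (fun k => sin (k%:R * t)) _ _ _ (sin_recurrence t) recy).
rewrite !mul0r cos0 sin0 !mul1r xn xn1 yn yn1 /h.
rewrite -natr1 mulrDl mul1r [_ + t]addrC.
have nt : n%:R * t = theta t + theta t - b%:R * pi by rewrite /theta; field.
rewrite !(cosD t) !(sinD t) nt cosB sinB cos_natpi sin_natpi !mulr0 !addr0.
rewrite (cosD (theta t)) (sinD (theta t)) !subr0.
(* As polynomials in the sines and cosines, the two sides differ by exactly this multiple of
   [1 - cos^2 - sin^2]. *)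
have E : (x 1%N - x 0%N * cos t - y 0%N * sin t) *
  (1 - (cos (theta t) ^+ 2 + sin (theta t) ^+ 2)) = 0.
  by rewrite cos2Dsin2 subrr mulr0.
apply/eqP; rewrite -subr_eq0; apply/eqP; rewrite -[RHS]E.
by case: b => /=; rewrite ?expr1 ?expr0; ring.
Qed.

(** Up to sign, the value of [h] at the zeros of [sin \o theta]. *)
Let r t := y 0%N * cos t - x 0%N * sin t - y 1%N.

Let r_zeros s : uniq s -> (forall t, t \in s -> 0 <= t < 2 * pi) ->
  (forall t, t \in s -> r t = 0) -> (size s <= 2)%N.
Proof.
move=> us s2 s0.
(* Degree one, with nonzero constant coefficient [- y 1]. *)
apply: (@trig_poly_zeros R (nth 0 [:: - y 1%N; y 0%N]) (nth 0 [:: 0; - x 0%N])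
  1 0 s) => //=; first by rewrite oppr_eq0.
move=> t /s0 <-; rewrite /trig_poly !big_nat_recr//= big_nil !(mul0r, mul1r, cos0, sin0).
by rewrite /r; ring.
Qed.

(** Where [cos t = d], [factorization] says nothing about the sum; such points have to be discarded,
    and this bounds their number. *)
Let cos_zeros s : uniq s -> (forall t, t \in s -> 0 <= t < 2 * pi) ->
  (forall t, t \in s -> cos t = d) -> (size s <= 2)%N.
Proof.
move=> us s2 s0.
apply: (@trig_poly_zeros R (nth 0 [:: - d; 1]) (fun=> 0) 1 1 s) => //=.
move=> t /s0 <-; rewrite /trig_poly !big_nat_recr//= big_nil !(mul0r, mul1r, cos0, sin0).
by ring.
Qed.

(* [p 0], ..., [p n.-1] are the zeros of [sin \o theta] in [[0, 2 pi[]. *)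
Let p (j : nat) : R := (2 * j%:R + b%:R) * pi / n%:R.

Let n0 : 0 < n%:R :> R. Proof. by rewrite ltr0n. Qed.

Let incp j : p j < p j.+1.
Proof.
rewrite /p ltr_pM2r ?invr_gt0// ltr_pM2r ?pi_gt0// ltrD2r ltr_pM2l//.
by rewrite ltr_nat.
Qed.

Let theta_p j : theta (p j) = (j + b)%:R * pi.
Proof. by rewrite /theta /p natrD; field; rewrite gt_eqF. Qed.

Let h_p j : h (p j) = (-1) ^+ (j + b) * r (p j).
Proof.
by rewrite /h sinD cosD theta_p cos_natpi sin_natpi /r; ring.
Qed.

Let p_ge0 j : 0 <= p j.
Proof. by rewrite /p divr_ge0// mulr_ge0 ?pi_ge0// addr_ge0. Qed.

Let p_lt j : (j < n)%N -> p j < 2 * pi.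
Proof.
move=> jn; rewrite /p ltr_pdivrMr// mulrAC ltr_pM2r ?pi_gt0//.
have bn : (2 * j + b < 2 * n)%N by case: (b) => /=; lia.
by rewrite -[X in X * _ + _]/(2%:R) -!natrM -natrD ltr_nat.
Qed.

Let continuous_theta : continuous theta.
Proof. by move=> t; apply: cvgD; [exact: cvgMr|exact: cvg_cst]. Qed.

Let continuous_h : continuous h.
Proof.
have ctt : continuous (fun t : R => t + theta t).
  by move=> t; apply: cvgD => //; exact: continuous_theta.
move=> t; apply: cvgB; [apply: cvgD; [apply: cvgB|]|]; apply: cvgMr.
- exact: (continuous_comp (continuous_theta t) (@continuous_sin R _)).
- exact: (continuous_comp (ctt t) (@continuous_sin R _)).
- exact: (continuous_comp (ctt t) (@continuous_cos R _)).
- exact: (continuous_comp (continuous_theta t) (@continuous_cos R _)).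
Qed.

Let continuous_r : continuous r.
Proof.
move=> t; apply: cvgB; [apply: cvgB|exact: cvg_cst]; apply: cvgMr.
- exact: continuous_cos.
- exact: continuous_sin.
Qed.

(* Half-open intervals are disjoint, so a zero of [r] is found in at most one of
   them; zeros at the right end point are accounted for separately. *)
Let left_zero j := `[< exists2 t, p j <= t < p j.+1 & r t = 0 >].
Let right_zero j := r (p j.+1) == 0.

(** The factor [(-1) ^+ (j + b)] alternates, so [h] changes sign wherever [r] keeps its sign.
    Otherwise the intermediate value theorem gives a zero of [r] that [left_zero] or [right_zero]
    detects. *)
Let h_sign_change j : ~~ left_zero j -> ~~ right_zero j ->
  h (p j) * h (p j.+1) < 0.
Proof.
move=> /asboolPn Bj rj; rewrite !h_p addSn exprS mulN1r mulNr mulrN oppr_lt0.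
rewrite mulrACA -exprMn mulrNN mulr1 expr1n mul1r ltNge; apply/negP => rr.
have [z] : exists2 z, z \in `[p j, p j.+1] & r z = 0.
  apply: IVT; first exact/ltW.
    exact: continuous_subspaceT.
  rewrite ge_min le_max.
  apply/andP; split; apply/negPn/negP; rewrite negb_or -!ltNge => /andP[u0 v0].
    by move: rr; rewrite leNgt mulr_gt0.
  by move: rr; rewrite leNgt nmulr_rgt0// v0.
rewrite in_itv /= => /andP[z1]; rewrite le_eqVlt => /orP[/eqP -> /eqP|z2 rz].
  by rewrite -/(right_zero j) (negbTE rj).
by apply: Bj; exists z => //; rewrite z1.
Qed.

(** Zeros of [r] taken in disjoint intervals are distinct. Indices stop at [n - 2], which keeps
    [p j.+1] below [2 pi]. *)
Let count_left : (count left_zero (iota 0 n.-1) <= 2)%N.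
Proof.
have /choice[z zP] j : exists t, left_zero j -> p j <= t < p j.+1 /\ r t = 0.
  have [/asboolP[t pt rt]|_] := boolP (left_zero j); last by exists 0.
  by exists t.
rewrite -size_filter -(size_map z); apply: r_zeros.
- rewrite map_inj_in_uniq ?filter_uniq ?iota_uniq// => i j.
  rewrite !mem_filter => /andP[/zP[/andP[i1 i2] _] _] /andP[/zP[/andP[j1 j2] _] _] zij.
  apply/eqP; rewrite eqn_leq.
  apply/andP; split; rewrite leqNgt; apply/negP => /(increasing_points incp); lra.
- move=> t /mapP[j]; rewrite mem_filter mem_iota => /andP[/zP[/andP[j1 j2] _] jn] ->.
  rewrite (le_trans (p_ge0 j) j1) (lt_trans j2)// p_lt//; lia.
- by move=> t /mapP[j]; rewrite mem_filter => /andP[/zP[]] _ + _ ->.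
Qed.

Let count_right : (count right_zero (iota 0 n.-1) <= 2)%N.
Proof.
rewrite -size_filter -(size_map (fun j => p j.+1)); apply: r_zeros.
- rewrite map_inj_in_uniq ?filter_uniq ?iota_uniq// => i j _ _ pij.
  apply/eqP; rewrite -eqSS eqn_leq.
  have := incp i.+1; have := incp j.+1 => pj pi.
  by apply/andP; split; rewrite leqNgt; apply/negP => /(increasing_points incp); lra.
- move=> t /mapP[j]; rewrite mem_filter mem_iota => /andP[_ jn] ->.
  rewrite p_ge0 p_lt//; lia.
- by move=> t /mapP[j]; rewrite mem_filter => /andP[/eqP ? _] ->.
Qed.

(** The [n] points [p j], with a zero of [h] in at least [n - 1 - 4] intervals, less at most two
    points where [cos t = d], leave [2 n - 7]. *)
Lemma num_zeros_ge :
  (((2 * n)%:R - 7)%:E <= num_zeros (trig_sum x y n) `[0%R, (2 * pi)%R])%E.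
Proof.
pose good j := ~~ left_zero j && ~~ right_zero j.
pose J := [seq j <- iota 0 n.-1 | good j].
have [z zP] := sign_change_zeros incp continuous_h.
have {}zP j : good j -> p j < z j < p j.+1 /\ h (z j) = 0.
  by move=> /andP[Lj Rj]; apply: zP; exact: h_sign_change.
have sizeJ : (n.-1 <= size J + 4)%N.
  rewrite -[X in (X <= _)%N](size_iota 0) -(count_predC good) -size_filter leq_add2l.
  apply: (@leq_trans (count (predU left_zero right_zero) (iota 0 n.-1))).
    by apply: sub_count => j /=; rewrite negb_and !negbK.
  rewrite -(leq_add2r (count (predI left_zero right_zero) (iota 0 n.-1))) count_predUI.
  by apply: leq_trans (leq_add count_left count_right) _; rewrite leq_addr.
pose L := [seq p j | j <- iota 0 n] ++ [seq z j | j <- J].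
have JP j : j \in J -> good j /\ (j < n.-1)%N.
  by rewrite mem_filter mem_iota => /andP[].
have uL : uniq L.
  rewrite cat_uniq; apply/and3P; split.
  - rewrite map_inj_in_uniq ?iota_uniq// => i j _ _ pij.
    have := incp i; have := incp j => pj pi; apply/eqP; rewrite eqn_leq.
    by apply/andP; split; rewrite leqNgt; apply/negP => /(increasing_points incp); lra.
  - apply/hasPn => _ /mapP[j /JP[/zP[zj _] _] ->]; apply/mapP => -[k] _.
    exact: (between_neq incp _ _ _ zj).
  - rewrite map_inj_in_uniq ?filter_uniq ?iota_uniq// => i j.
    move=> /JP[/zP[zi _] _] /JP[/zP[zj _] _].
    exact: (between_inj incp _ _ _ zi zj).
have LP t : t \in L -> 0 <= t < 2 * pi /\ sin (theta t) * h t = 0.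
  rewrite mem_cat => /orP[|] /mapP[j].
    rewrite mem_iota => jn ->; split; first by rewrite p_ge0 p_lt.
    by rewrite theta_p sin_natpi mul0r.
  move=> /JP[/zP[/andP[z1 z2] hz] jn] ->; split; last by rewrite hz mulr0.
  rewrite (le_trans (p_ge0 j) (ltW z1)) (lt_trans z2)// p_lt//; lia.
have sizeL : (2 * n <= size L + 5)%N.
  by rewrite size_cat !size_map size_iota; lia.
have := count_predC (fun t => cos t == d) L; rewrite -2!size_filter.
set L1 := [seq t <- L | _]; set L2 := [seq t <- L | _] => sL.
have sL1 : (size L1 <= 2)%N.
  apply: cos_zeros; first exact: filter_uniq.
    by move=> t; rewrite mem_filter => /andP[_ /LP[]].
  by move=> t; rewrite mem_filter => /andP[/eqP].
apply: (@le_trans _ _ (size L2)%:R%:E).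
  by rewrite lee_fin lerBlDr -natrD ler_nat; lia.
apply: counting_ge_size; first exact: filter_uniq.
move=> t; rewrite mem_filter /= => /andP[td /LP[/andP[t0 t2] ht]].
split; first by rewrite in_itv /= t0 ltW.
apply: (@mulfI _ (2 * (cos t - d))).
  by rewrite mulf_neq0 ?pnatr_eq0// subr_eq0.
by rewrite factorization -mulrA ht !mulr0.
Qed.

End commensurable_angle.

(** * Expectations of combinations, products and squares *)

Section expectations.
Context {d : measure_display} {T : measurableType d} {R : realType}.
Context {P : probability T R}.

Lemma expectation_lincomb (I : eqType) (r : seq I) (c : I -> R)
    (f : I -> T -> R) : (forall i, i \in r -> f i \in Lfun P 1) ->
  ('E_P[(fun w => \sum_(i <- r) c i * f i w)%R] =
   \sum_(i <- r) (c i)%:E * 'E_P[f i])%E.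
Proof.
move=> fL.
have -> : (fun w => \sum_(i <- r) c i * f i w) =
    \sum_(g <- [seq c i \o* f i | i <- r]) g.
  apply/funext => w; rewrite fct_sumE big_map.
  by apply: eq_bigr => i _ /=; rewrite mulrC.
rewrite expectation_sum ?big_map => [|g /mapP[i ir ->]]; last first.
  by rewrite Lfun_scale// fL.
by apply: eq_big_seq => i ir; rewrite expectationZl// fL.
Qed.

(** Domination by [|X Y| <= X^2 + Y^2]. *)
Lemma sqr_expectation_Lfun (X Y : {RV P >-> R}) : ('E_P[X \* X] < +oo)%E ->
  ('E_P[Y \* Y] < +oo)%E -> X \* Y \in Lfun P 1.
Proof.
rewrite !unlock => X2 Y2.
have int2 (Z : {RV P >-> R}) : (\int[P]_w ((Z \* Z) w)%:E < +oo)%E ->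
    P.-integrable setT (EFin \o (Z \* Z)).
  move=> Z2; apply/integrableP; split.
    by apply/measurable_EFinP; exact: measurable_funM.
  under eq_integral => w _ do rewrite /= ger0_norm ?sqr_ge0//.
  exact: Z2.
apply/Lfun1_integrable.
apply: (le_integrable _ _ _ (integrableD _ (int2 X X2) (int2 Y Y2))) => //.
  by apply/measurable_EFinP; exact: measurable_funM.
move=> w _ /=; rewrite lee_fin normrM.
rewrite [leRHS]ger0_norm ?addr_ge0 ?sqr_ge0// -!expr2.
rewrite -(real_normK (num_real (X w))) -(real_normK (num_real (Y w))).
have := sqr_ge0 (`|X w| - `|Y w|); have := mulr_ge0 (normr_ge0 (X w)) (normr_ge0 (Y w)).
by rewrite sqrrB; lra.
Qed.

Lemma expectation_sqr_eq0 (W : T -> R) : measurable_fun setT W ->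
  ('E_P[W \* W] = 0)%E -> {ae P, forall w, W w = 0}.
Proof.
move=> mW; rewrite unlock => W0.
pose W2 : T -> \bar R := EFin \o (W \* W).
have mW2 : measurable_fun setT W2.
  by apply/measurable_EFinP; exact: measurable_funM.
have /(ae_eq_integral_abs P measurableT mW2) : (\int[P]_x `|W2 x| = 0)%E.
  rewrite -[RHS]W0; apply: eq_integral => w _ /=.
  by rewrite ger0_norm ?sqr_ge0.
apply: filterS => w /(_ Logic.I) [] /eqP.
by rewrite mulf_eq0 orbb => /eqP.
Qed.

End expectations.

(** * Linear relations and absence of atoms for the cosine covariance *)

Section cosine_process.
Context {d : measure_display} {T : measurableType d} {R : realType}.
Context {P : probability T R} {X : nat -> {RV P >-> R}} {alpha : R}.
Hypothesis stX :
  stationary_gaussian_process (fun k : int => cos (k%:~R * alpha)) X.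

Lemma stationary_sqr k : (1 <= k)%N -> ('E_P[X k \* X k] = 1)%E.
Proof. by have [_ _ EX2] := stX => k1; rewrite EX2// subrr mul0r cos0. Qed.

(** By the subtraction formula for the cosine, the second moment of the combination is the sum of
    the squares of the two deterministic sums, hence zero. The list [r] holds pairs of a coefficient
    and an index. *)
Lemma ae_linear_relation (r : seq (R * nat)) :
  (forall q, q \in r -> (1 <= q.2)%N) ->
  \sum_(q <- r) q.1 * cos (q.2%:R * alpha) = 0 ->
  \sum_(q <- r) q.1 * sin (q.2%:R * alpha) = 0 ->
  {ae P, forall w, \sum_(q <- r) q.1 * X q.2 w = 0}.
Proof.
move=> r1 rcos rsin; apply: expectation_sqr_eq0.
  by apply: measurable_sum => q; exact: measurable_funM.
pose r2 := [seq (q, q') | q <- r, q' <- r].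
rewrite (_ : _ \* _ = fun w => \sum_(qq <- r2)
    (qq.1.1 * qq.2.1) * (X qq.1.2 \* X qq.2.2) w); last first.
  apply/funext => w /=; rewrite big_distrlr /= big_allpairs.
  by apply: eq_bigr => q _; apply: eq_bigr => q' _; rewrite mulrACA.
have r2P qq : qq \in r2 -> qq.1 \in r /\ qq.2 \in r.
  by move=> /allpairsP[[q q'] [? ? ->]].
rewrite (expectation_lincomb _ r2 (fun qq => qq.1.1 * qq.2.1) (fun qq => X qq.1.2 \* X qq.2.2)); last first.
  move=> qq /r2P[/r1 q1 /r1 q2].
  by apply: sqr_expectation_Lfun; rewrite stationary_sqr// ltry.
have [_ _ EXX] := stX.
rewrite (eq_big_seq (fun qq => (qq.1.1 * qq.2.1 *
  cos ((qq.1.2%:R - qq.2.2%:R) * alpha))%:E)) => [|qq /r2P[/r1 q1 /r1 q2]]; last first.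
  by rewrite EXX// EFinM intrB.
rewrite sumEFin big_allpairs /=; congr (_%:E).
transitivity ((\sum_(q <- r) q.1 * cos (q.2%:R * alpha)) ^+ 2 +
              (\sum_(q <- r) q.1 * sin (q.2%:R * alpha)) ^+ 2); last first.
  by rewrite rcos rsin; ring.
rewrite !expr2 !big_distrlr /= -big_split /=.
apply: eq_bigr => q _; rewrite -big_split /=.
by apply: eq_bigr => q' _; rewrite mulrBl cosB; ring.
Qed.

Lemma ae_linear_relation3 (c1 c2 c3 : R) (k1 k2 k3 : nat) :
  (1 <= k1)%N -> (1 <= k2)%N -> (1 <= k3)%N ->
  c1 * cos (k1%:R * alpha) + c2 * cos (k2%:R * alpha) +
    c3 * cos (k3%:R * alpha) = 0 ->
  c1 * sin (k1%:R * alpha) + c2 * sin (k2%:R * alpha) +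
    c3 * sin (k3%:R * alpha) = 0 ->
  {ae P, forall w, c1 * X k1 w + c2 * X k2 w + c3 * X k3 w = 0}.
Proof.
move=> h1 h2 h3 hcos hsin.
have := @ae_linear_relation [:: (c1, k1); (c2, k2); (c3, k3)].
rewrite !big_cons !big_nil /= !addr0 !addrA => /(_ _ hcos hsin) H.
have {}H := H _; apply: filterS (H _) => [w|q]; last first.
  by rewrite !inE => /or3P[] /eqP ->.
by rewrite !big_cons !big_nil /= !addr0 !addrA.
Qed.

(** Indicator coefficients show that [X k] is Gaussian. A normal law is absolutely continuous; a
    Dirac law at [m] would have [m = 0] by the mean and [m^2 = 1] by the second moment. *)
Lemma stationary_atomless k x : (1 <= k)%N -> P (X k @^-1` [set x]) = 0%E.
Proof.
move=> k1; have [gX EX0 _] := stX.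
have sumE : (fun w => \sum_(1 <= j < k.+1) (j == k)%:R * X j w) = X k.
  apply/funext => w; rewrite big_nat_recr//= eqxx mul1r big_nat big1 ?add0r//.
  by move=> j /andP[_ jk]; rewrite (ltn_eqF jk) mul0r.
have [m [[s s0]|]] := gX k (fun j => (j == k)%:R); rewrite sumE => PX.
  have := PX _ (measurable_set1 x); rewrite /pushforward => ->.
  have /null_content_dominatesP := normal_prob_dominates m s.
  by apply; [exact: measurable_set1|exact: lebesgue_measure_set1].
have aeX : {ae P, forall w, X k w = m}.
  exists (X k @^-1` (~` [set m])); split => //.
  - by rewrite -[X in measurable X]setTI; apply: measurable_funP => //; exact: measurableC.
  - have := PX _ (measurableC (measurable_set1 m)).
    by rewrite /pushforward diracE memNset//= => ->.
have Em : ('E_P[X k] = m%:E)%E.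
  rewrite -(expectation_cst P m) !unlock; apply: ae_eq_integral => //.
  - exact/measurable_EFinP.
  - exact/measurable_EFinP.
  - by apply: filterS aeX => w -> _.
have Em2 : ('E_P[X k \* X k] = (m * m)%:E)%E.
  rewrite -(expectation_cst P (m * m)) !unlock; apply: ae_eq_integral => //.
  - by apply/measurable_EFinP; exact: measurable_funM.
  - exact/measurable_EFinP.
  - by apply: filterS aeX => w /= -> _.
move: Em2; rewrite stationary_sqr//; move: Em; rewrite EX0// => -[<-] [].
by rewrite mul0r => /eqP; rewrite oner_eq0.
Qed.

End cosine_process.

(** * Linear combinations of two independent variables *)

Lemma independent_line_null (d : measure_display) (T : measurableType d)
    (R : realType) (P : probability T R) (X Y : {RV P >-> R}) (b c : R) :
  (forall A B, measurable A -> measurable B ->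
     P (X @^-1` A `&` Y @^-1` B) = (P (X @^-1` A) * P (Y @^-1` B))%E) ->
  (forall x, P (X @^-1` [set x]) = 0%E) -> b != 0 ->
  P [set w | b * X w + c * Y w = 0] = 0%E.
Proof.
move=> indep X0 b0.
have mZ : measurable_fun setT (fun w => (Y w, X w)) by exact: measurable_fun_pair.
pose Z : {mfun T >-> (R * R)%type} := mfun_Sub (mem_set mZ).
pose D := [set z : R * R | b * z.2 + c * z.1 = 0].
have mD : measurable D.
  have mg : measurable_fun setT (fun z : R * R => b * z.2 + c * z.1).
    by apply: measurable_funD; apply: measurable_funM.
  by rewrite -[D]setTI; exact: (mg measurableT [set 0] (measurable_set1 _)).
transitivity (distribution P Z D) => //.
(* By independence [(Y, X)] has the product law, computed by integrating over sections of [D]; each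
   section is a single point, null for the law of [X]. *)
rewrite -(@product_measure_unique _ _ _ _ R (distribution P Y) (distribution P X)) //.
  apply: integral0_eq => y _ /=.
  rewrite (_ : xsection D y = [set - (c * y) / b]); first exact: X0.
  apply/seteqP; split=> x; rewrite /xsection /= inE /D /=.
    by move=> bc0; apply: (mulfI b0); rewrite mulrCA divff// mulr1; lra.
  by move=> ->; rewrite mulrCA divff// mulr1 addNr.
move=> A B mA mB /=.
by rewrite /distribution /= /pushforward muleC -indep// setIC.
Qed.

(** * Integral bounds without measurability *)

Section ge0_integral.
Context {d : measure_display} {T : measurableType d} {R : realType}.
Context {P : probability T R}.
Import HBNNSimple.
Implicit Types f g : T -> \bar R.

Let le_integralT f g : (forall x, 0 <= f x)%E -> (forall x, f x <= g x)%E ->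
  (\int[P]_x f x <= \int[P]_x g x)%E.
Proof.
move=> f0 fg; rewrite !ge0_integralTE// => [|x]; last exact: le_trans (fg x).
by apply: le_ereal_sup => _ [h hf <-]; exists h => // x; exact: le_trans (fg x).
Qed.

(* The integral of a nonnegative function is a supremum over simple functions
   below it, so [f] need not be measurable. *)
Lemma ae_bounds_integral f (l u : R) : (forall x, 0 <= f x)%E -> 0 <= u ->
  {ae P, forall x, (l%:E <= f x <= u%:E)%E} ->
  (l%:E <= \int[P]_x f x <= u%:E)%E.
Proof.
move=> f0 u0 [N [mN PN fN]].
have lfu x : x \notin N -> (l%:E <= f x <= u%:E)%E.
  by move=> xN; apply/negPn/negP => lx; move/negP: xN; apply; rewrite inE; apply: fN => /= /(negP lx).
apply/andP; split.
  have [l0|l0] := leP l 0; first by rewrite (@le_trans _ _ 0%E)// ?lee_fin// integral_ge0.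
  (* The function equal to [l] off the null set [N] and to [0] on it is a minorant of [f] with
     integral [l]. *)
  have -> : l%:E = (\int[P]_x (l * \1_(~` N) x)%:E)%E.
    rewrite (@integralZl_indic _ _ _ P setT _ (fun=> ~` N))//.
    - rewrite integral_indic ?setIT//; last exact: measurableC.
      have PN1 : P (~` N) = 1%E by rewrite probability_setC// PN sube0.
      by rewrite -[LHS]mule1; congr (_ * _)%E; exact/esym.
    - by move=> l1; move: l0; rewrite ltNge (ltW l1).
    - exact: measurableC.
  apply: le_integralT => x.
    by rewrite lee_fin mulr_ge0// ltW.
  have [xN|xN] := boolP (x \in N).
    by rewrite indicE in_setC xN mulr0.
  by rewrite indicE in_setC xN mulr1; case/andP: (lfu x xN).
(* A simple function below [f] is at most [u] off [N], so its integral is at most [u]. *)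
rewrite ge0_integralTE//; apply: ge_ereal_sup => _ [h hf <-].
rewrite -integralT_nnsfun -[leRHS]mule1 -(@probability_setT _ _ _ P) -integral_cst//.
apply: ae_ge0_le_integral => //.
- by move=> x _; rewrite lee_fin.
- exact/measurable_EFinP.
- exists N; split=> // x; apply: contra_notP => xN _.
  by apply: le_trans (hf x) _; case/andP: (lfu x (negbT (memNset xN))).
Qed.

End ge0_integral.

(** * Almost sure relations along a sample path *)

Section almost_sure_facts.
Context {d : measure_display} {T : measurableType d} {R : realType}.
Context {P : probability T R} {X : nat -> {RV P >-> R}} {alpha : R}.
Hypothesis stX :
  stationary_gaussian_process (fun k : int => cos (k%:~R * alpha)) X.

Lemma ae_neq0 k : (1 <= k)%N -> {ae P, forall w, X k w != 0}.
Proof.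
move=> k1; exists (X k @^-1` [set 0]); split.
- by rewrite -[X in measurable X]setTI; apply: measurable_funP.
- exact: (stationary_atomless stX).
- by move=> w /= /negP/negPn/eqP.
Qed.

(* The value at [0] is the one prescribed by the three-term recurrence. *)
Definition extend0 (c : R) (u : nat -> R) (k : nat) : R :=
  if k == 0%N then 2 * c * u 1%N - u 2%N else u k.

(** Each relation is inherited from [cos (k alpha)] and [sin (k alpha)], for which a shift of the
    index by [n] is multiplication by [(-1)^m]. *)
Lemma ae_extend0 (n m : nat) : (0 < n)%N -> n%:R * alpha = m%:R * pi ->
  {ae P, forall w, let x := extend0 (cos alpha) (X^~ w) in
    [/\ forall k, (k < n)%N -> x k.+2 + x k = 2 * cos alpha * x k.+1,
        x n = (-1) ^+ odd m * x 0%N & x n.+1 = (-1) ^+ odd m * x 1%N]}.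
Proof.
move=> n0 nm; set e := (-1) ^+ odd m.
have cn : cos (n%:R * alpha) = e by rewrite nm cos_natpi /e signr_odd.
have sn : sin (n%:R * alpha) = 0 by rewrite nm sin_natpi.
have succ (k : nat) : k.+1%:R * alpha = k%:R * alpha + alpha by rewrite -natr1; ring.
have rec : {ae P, forall w, forall k,
    1 * X k.+3 w + 1 * X k.+1 w + - (2 * cos alpha) * X k.+2 w = 0}.
  apply: ae_foralln => k; apply: (ae_linear_relation3 stX) => //.
    rewrite (_ : k.+1%:R * alpha = k.+2%:R * alpha - alpha); last by rewrite (succ k.+1) addrK.
    by rewrite (succ k.+2) cosD cosB; ring.
  rewrite (_ : k.+1%:R * alpha = k.+2%:R * alpha - alpha); last by rewrite (succ k.+1) addrK.
  by rewrite (succ k.+2) sinD sinB; ring.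
(* This is [x n = e * x 0] with [x 0] written out through indices [1] and [2]. *)
have reln : {ae P, forall w,
    1 * X n w + - (2 * e * cos alpha) * X 1%N w + e * X 2%N w = 0}.
  apply: (ae_linear_relation3 stX) => //.
    by rewrite cn (succ 1) !mul1r cosD -!expr2 sin2cos2; ring.
  by rewrite sn (succ 1) !mul1r sinD; ring.
have reln1 : {ae P, forall w, 1 * X n.+1 w + - e * X 1%N w + 0 * X 1%N w = 0}.
  apply: (ae_linear_relation3 stX) => //.
    by rewrite succ cosD cn sn !mul1r; ring.
  by rewrite succ sinD cn sn !mul1r; ring.
apply: filterS3 rec reln reln1 => w hrec hn hn1; rewrite /extend0 /=; split.
- case=> [|k] _ /=; first by ring.
  by have := hrec k; lra.
- by rewrite gtn_eqF//; lra.
- by lra.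
Qed.

End almost_sure_facts.

(** * Zeros of the random polynomial, almost surely and in expectation *)

Lemma num_zeros_random_trig_poly (d : measure_display) (T : measurableType d)
    (R : realType) (P : probability T R) (a b : nat -> {RV P >-> R})
    (x y : nat -> R) (n : nat) (w : T) (D : set R) : (0 < n)%N ->
  (forall k, (0 < k <= n)%N -> a k w = x k) ->
  (forall k, (0 < k <= n)%N -> b k w = y k) ->
  num_zeros (random_trig_poly a b n w) D = num_zeros (trig_sum x y n) D.
Proof.
move=> n0 ax bY; rewrite /num_zeros; congr counting.
have sum t : random_trig_poly a b n w t =
    (Num.sqrt n%:R)^-1 * trig_sum x y n t.
  rewrite /random_trig_poly; congr (_ * _); apply: eq_big_nat => k kn.
  by rewrite ax// bY.
apply/seteqP; split=> t [Dt] /=; rewrite sum => ft; split=> //.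
  move/eqP: ft; rewrite mulf_eq0 invr_eq0 gt_eqF ?sqrtr_gt0 ?ltr0n//=.
  by move/eqP.
by rewrite ft mulr0.
Qed.

Section almost_sure_zeros.
Context {d : measure_display} {T : measurableType d} {R : realType}.
Context {P : probability T R} {alpha : R} {a b : nat -> {RV P >-> R}}.
Hypotheses
  (ha : stationary_gaussian_process (fun k : int => cos (k%:~R * alpha)) a)
  (hb : stationary_gaussian_process (fun k : int => cos (k%:~R * alpha)) b)
  (hab : independent_processes a b).

Let ae_and (A B : T -> Prop) : {ae P, forall w, A w} ->
  {ae P, forall w, B w} -> {ae P, forall w, A w /\ B w}.
Proof. exact: filterI. Qed.

Lemma independent_coordinates (A B : set R) : measurable A -> measurable B ->
  P (a 1%N @^-1` A `&` b 1%N @^-1` B) =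
  (P (a 1%N @^-1` A) * P (b 1%N @^-1` B))%E.
Proof.
move=> mA mB; apply: hab; apply: sub_sigma_algebra.
  by exists 1%N => //; exists A => //; rewrite setTI.
by exists 1%N => //; exists B => //; rewrite setTI.
Qed.

Lemma ae_lincomb_neq0 (r s : R) : (r != 0) || (s != 0) ->
  {ae P, forall w, a 1%N w * r + b 1%N w * s != 0}.
Proof.
have [->|r0 _] := eqVneq r 0.
  move=> /= s0; apply: filterS (ae_neq0 hb 1%N isT) => w b0.
  by rewrite mulr0 add0r mulf_neq0.
exists [set w | r * a 1%N w + s * b 1%N w = 0]; split.
- have mf : measurable_fun setT (fun w => r * a 1%N w + s * b 1%N w).
    by apply: measurable_funD; apply: measurable_funM.
  rewrite -[X in measurable X]setTI; exact: (mf measurableT [set 0]).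
- apply: independent_line_null => // [A B|x]; first exact: independent_coordinates.
  exact: (stationary_atomless ha).
- by move=> w /= /negP/negPn/eqP; rewrite mulrC [b _ _ * _]mulrC.
Qed.

Lemma ae_num_zeros_const n : alpha = 0 -> (0 < n)%N ->
  {ae P, forall w : T,
     num_zeros (random_trig_poly a b n w) `[0, 2 * pi] = ((2 * n)%:R)%:E}.
Proof.
move=> alpha0 n0.
have const (X : nat -> {RV P >-> R}) :
    stationary_gaussian_process (fun k : int => cos (k%:~R * alpha)) X ->
    {ae P, forall w, forall k, X k.+1 w = X 1%N w}.
  move=> hX; apply: ae_foralln => k.
  (* The relation [X k.+1 - X 1 = 0], padded by a third term with coefficient [0]. *)
  have /= H := ae_linear_relation3 hX 1 (-1) 0 k.+1 1 1 isT isT isT.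
  rewrite alpha0 !mulr0 sin0 cos0 in H.
  apply: filterS (H _ _) => [w||]; [lra|ring|ring].
(* Excludes common zeros of the two factors: one null set for each of countably many angles. *)
have coincide : {ae P, forall w, forall i, (0 < i < n)%N ->
     a 1%N w * cos (n.+1%:R * (i%:R * pi / n%:R)) +
     b 1%N w * sin (n.+1%:R * (i%:R * pi / n%:R)) != 0}.
  apply: ae_foralln => i; set t := _ * _.
  have : (cos t != 0) || (sin t != 0).
    apply/negPn/negP; rewrite negb_or !negbK => /andP[/eqP c0 /eqP s0].
    by have := cos2Dsin2 t; rewrite c0 s0 expr0n addr0 => /eqP; rewrite eq_sym oner_eq0.
  by move=> /ae_lincomb_neq0; apply: filterS => w.
apply: filterS (ae_and _ _ (ae_and _ _ (const a ha) (const b hb))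
  (ae_and _ _ (ae_neq0 ha 1%N isT) coincide)) => w [[aw bw] [a0 ab0]].
rewrite (num_zeros_random_trig_poly _ _ _ _ _ _ (fun=> a 1%N w) (fun=> b 1%N w))//.
- exact: num_zeros_const.
- by case.
- by case.
Qed.

Lemma ae_num_zeros_bounds (n m : nat) : (0 < n)%N -> n%:R * alpha = m%:R * pi ->
  {ae P, forall w : T,
    (((2 * n)%:R - 7)%:E <=
     num_zeros (random_trig_poly a b n w) `[0%R, (2 * pi)%R] <=
     ((2 * n).+1)%:R%:E)%E}.
Proof.
move=> n0 nm.
apply: filterS (ae_and _ _
  (ae_and _ _ (ae_extend0 ha _ _ n0 nm) (ae_extend0 hb _ _ n0 nm))
  (ae_and _ _ (ae_neq0 ha 1%N isT) (ae_neq0 hb 1%N isT))) => w [[] []].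
set x := extend0 _ _ => rx xn xn1 []; set y := extend0 _ _ => ry yn yn1 [a0 b0].
rewrite (num_zeros_random_trig_poly _ _ _ _ _ _ x y)//; last 2 first.
- by case.
- by case.
by rewrite (num_zeros_ge n0 rx ry xn xn1 yn yn1)//= num_zeros_le.
Qed.

Lemma expected_num_zeros_bounds (n : nat) : 0 <= alpha -> (0 < n)%N ->
  pi_int (n%:R * alpha) ->
  (`|(\int[P]_w num_zeros (random_trig_poly a b n w) `[0%R, (2 * pi)%R]) *
      (n%:R^-1)%:E - 2%:E| <= (7 * n%:R^-1)%:E)%E.
Proof.
move=> alpha0 n0 [m _ mpi].
have npos : 0 < n%:R :> R by rewrite ltr0n.
(* Since [alpha >= 0], the integer [m] can be taken as a natural number. *)
have m0 : 0 <= m.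
  have : 0 <= pi * m%:~R :> R by rewrite mpi mulr_ge0.
  by rewrite pmulr_rge0 ?pi_gt0// ler0z.
have nm : n%:R * alpha = `|m|%N%:R * pi.
  by rewrite -mpi mulrC; congr (_ * _); rewrite -[in LHS](gez0_abs m0).
have zeros0 w : (0%E <= num_zeros (random_trig_poly a b n w) `[0%R, (2 * pi)%R])%E.
  exact: counting_ge_size [::] _ _.
have u0 : 0 <= (2 * n).+1%:R :> R by [].
have := ae_bounds_integral _ _ _ zeros0 u0 (ae_num_zeros_bounds n _ n0 nm).
(* The bounds exclude infinite values; a finite integral [z] satisfies [-7 <= z - 2 n <= 1]. *)
case: (\int[P]_w _)%E => [z| |]; [|by rewrite andbF|by []].
rewrite (_ : abse _ = (`|z * n%:R^-1 - 2|)%R%:E)// !lee_fin => /andP[lz zu].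
rewrite -(ler_pM2r npos) -[X in _ * X <= _](gtr0_norm npos) -normrM.
rewrite divfK ?gt_eqF// mulrBl divfK ?gt_eqF// -natrM mulnC.
rewrite -[(2 * n).+1]addn1 natrD in zu.
by rewrite ler_norml; apply/andP; split; lra.
Qed.

End almost_sure_zeros.

Theorem proposition1p1 (R : realType) (d : measure_display)
    (T : measurableType d) (P : probability T R) (alpha : R)
    (halpha : 0 <= alpha) (a b : nat -> {RV P >-> R})
    (ha : stationary_gaussian_process (fun k : int => cos (k%:~R * alpha)) a)
    (hb : stationary_gaussian_process (fun k : int => cos (k%:~R * alpha)) b)
    (hab : independent_processes a b) :
  (alpha = 0 -> forall n : nat, (1 <= n)%N ->
     {ae P, forall w : T,
        num_zeros (random_trig_poly a b n w) `[0, 2 * pi] = ((2 * n)%:R)%:E})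
  /\
  (alpha \in pi_rat ->
     (fun n : nat =>
        (`| (\int[P]_w num_zeros (random_trig_poly a b n w) `[0%R, (2 * pi)%R])
              * (n%:R^-1)%:E - 2%:E |
         * (\1_pi_int (n%:R * alpha))%:E)%E) @ \oo --> 0%E).
Proof.
split=> [alpha0 n n1|_]; first exact: (ae_num_zeros_const ha hb hab _ alpha0 n1).
(* Squeeze by [7 / n]: this bounds the distance to [2] when [n alpha] is in [pi_int], and otherwise
   the indicator is zero. *)
have inv0 : (fun n : nat => (7 * n%:R^-1 : R)%:E) @ \oo --> 0%E.
  apply: cvg_EFin; first by near=> n.
  rewrite -[0](mulr0 7); apply: cvgMr.
  by rewrite -cvg_shiftS; exact: cvg_harmonic.
apply: (squeeze_cvge _ (@cvg_cst _ _ _ _ _) inv0).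
near=> n; apply/andP; split; first by rewrite mule_ge0// lee_fin.
rewrite indicE; have [/set_mem npi|_] := boolP (_ \in pi_int).
  rewrite mule1; apply: (expected_num_zeros_bounds ha hb) => //.
  by near: n; exists 1%N.
by rewrite mule0 lee_fin mulr_ge0.
Unshelve. all: by end_near.
Qed.
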